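(* Let $n\ge 2$ be an integer, let $A$ be a ring, let $B$ be a Banach algebra, and let $\delta$ and $\varepsilon$ be nonnegative real numbers. Suppose $f:A\to B$ is a mapping such that $$\|f(a+b)-f(a)-f(b)\|\leq\varepsilon$$ for all $a,b\in A$, and $$\Big\|f\Big(\prod_{i=1}^n a_i\Big)-\prod_{i=1}^n f(a_i)\Big\|\leq\delta$$ for all $a_1,a_2,\dots,a_n\in A$. Then there exists a unique $n$-ring homomorphism $h:A\to B$ such that $$\|f(a)-h(a)\|\leq\varepsilon$$ for all $a\in A$. Furthermore, this $h$ satisfies $$\Big(\prod_{i=1}^k h(a_i)\Big)\Big(\prod_{i=k+1}^n f(a_i)-\prod_{i=k+1}^n h(a_i)\Big)=0$$ and $$\Big(\prod_{i=1}^k f(a_i)-\prod_{i=1}^k h(a_i)\Big)\Big(\prod_{i=k+1}^n h(a_i)\Big)=0$$ for all $a_1,a_2,\dots,a_n\in A$ and all $k\in\{1,2,\dots,n-1\}$.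
   Context: Rings and algebras are associative, and are not assumed to be commutative or unital. All products $\prod_{i=j}^{k} x_i$ are ordered products $x_j x_{j+1}\cdots x_k$. For rings $A,B$ and an integer $n\ge 2$, an additive map $h:A\to B$ (i.e. $h(a+b)=h(a)+h(b)$ for all $a,b\in A$) is called an $n$-ring homomorphism if $h\big(\prod_{i=1}^n a_i\big)=\prod_{i=1}^n h(a_i)$ for all $a_1,\dots,a_n\in A$. *)

(* Defs.v *)
From HB Require Import structures.
From mathcomp Require Import all_boot all_order all_algebra.
From mathcomp Require Import all_classical all_reals all_analysis.
From mathcomp Require Import complex.

Set Implicit Arguments.
Unset Strict Implicit.
Unset Printing Implicit Defensive.

Import Order.TTheory GRing.Theory Num.Theory.
Import numFieldNormedType.Exports.

Local Open Scope ring_scope.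

(* MathComp's ring structures are all unital, hence this one: associative,
   with neither a unit nor commutativity. *)
HB.mixin Record Zmodule_isNonUnitalRing A of GRing.Zmodule A := {
  numul : A -> A -> A;
  numulA : associative numul;
  numulDl : left_distributive numul +%R;
  numulDr : right_distributive numul +%R
}.

#[short(type="nonUnitalRingType")]
HB.structure Definition NonUnitalRing :=
  {A of GRing.Zmodule A & Zmodule_isNonUnitalRing A}.

Notation "x ** y" := (numul x y) (at level 40, left associativity) : ring_scope.

HB.mixin Record NonUnitalRing_isBanachAlgebra (K : numFieldType) B
    of CompleteNormedModule K B & NonUnitalRing B := {
  numul_scalel : forall (c : K) (x y : B), (c *: x) ** y = c *: (x ** y);
  numul_scaler : forall (c : K) (x y : B), x ** (c *: y) = c *: (x ** y);
  normM_le : forall x y : B, `|x ** y| <= `|x| * `|y|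
}.

#[short(type="banachAlgType")]
HB.structure Definition BanachAlgebra (K : numFieldType) :=
  {B of CompleteNormedModule K B & NonUnitalRing B
      & NonUnitalRing_isBanachAlgebra K B}.

(* A Banach algebra is over the reals or over the complex numbers. *)
Variant scalars := RealScalars | ComplexScalars.

(* The norm of a normed module over K has its values in K. For K = R[i],
   0 <= z holds exactly when z is a nonnegative real number, so the nonnegative
   elements of [scalar_field R s] are the nonnegative reals in both cases. *)
Definition scalar_field (R : realType) (s : scalars) : numFieldType :=
  match s with
  | RealScalars => R
  | ComplexScalars => R[i]
  end.

(* a j ** a j.+1 ** ... ** a k, for j <= k. In the absence of a unit, the
   product is started from its first factor (the value for k < j is a j). *)
Definition oprod (A : nonUnitalRingType) (j k : nat) (a : nat -> A) : A :=
  foldl (fun x i => x ** a i) (a j) (iota j.+1 (k - j)).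

Notation "\oprod_ ( j <= i <= k ) E" := (oprod j k (fun i => E))
  (at level 36, E at level 36, i at level 50, j at level 50, k at level 50,
   format "\oprod_ ( j  <=  i  <=  k )  E") : ring_scope.

(* An n-tuple a_1, ..., a_n is given by the values at 1, ..., n of a sequence
   nat -> A; the other values do not occur in the product. *)
Definition nring_hom (A B : nonUnitalRingType) (n : nat) (h : A -> B) : Prop :=
  {morph h : x y / x + y} /\
  forall a : nat -> A,
    h (\oprod_(1 <= i <= n) a i) = \oprod_(1 <= i <= n) h (a i).

(* Main.v *)
Require Import Defs.
From mathcomp Require Import all_boot all_order all_algebra.
From mathcomp Require Import all_classical all_reals all_analysis.
From mathcomp Require Import complex.
Import Order.TTheory GRing.Theory Num.Theory.
Import numFieldNormedType.Exports.
Set Implicit Arguments.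
Unset Strict Implicit.
Unset Printing Implicit Defensive.
Local Open Scope ring_scope.

(** The additive part is Hyers's theorem.  Almost additivity makes
    [f (a *+ N)] differ from [f a *+ N] by at most [eps * N], so the averages
    [N^-1 *: f (a *+ N)] form a Cauchy sequence; their limit [h a] is additive
    in [a] and stays within [eps] of [f a] ([hyers]).  Conversely, an additive
    [g] within [eps] of [f] satisfies
    [`|N^-1 *: f (a *+ N) - g a| <= eps / N], hence it is that limit: this gives
    uniqueness ([additive_harmonic_limit], [harmonic_limit_unique]).

    All the multiplicative claims come from one identity ([mixed_oprod]).  Choose
    a set [P] of positions that meets [1, ..., n], and replace [a i] by
    [a i *+ N] for [i] in [P].  The product of the new factors is the old one
    times [M], a power of [N] with exponent at least one.  In

      [`|f ((a 1 ** ... ** a n) *+ M) - f (a' 1) ** ... ** f (a' n)| <= delta]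

    divide by [M] and let [N] tend to infinity.  The error vanishes, the first
    term tends to [h (a 1 ** ... ** a n)], and in the second one the factors at
    the positions in [P] tend to [h (a i)] while the others remain [f (a i)].
    So [h (a 1 ** ... ** a n)] is a product in which each factor may be either
    [h (a i)] or [f (a i)], provided that [h] occurs at least once.  Taking [P]
    to be all positions, the first [k], or the last [n - k], one finds that [h]
    is an n-ring homomorphism and that both orthogonality relations hold, as
    differences of two such products.

    Since every limit here is reached at the rate [1 / N], convergence is
    expressed by that rate ([harmonic_limit]); the passage to the limit in a
    product is then a plain estimate.  The scalars enter only through the
    Archimedean property of their nonnegative elements, which are real numbers
    for the real as well as for the complex field. *)

(** * Ordered products in non-unital rings *)

Section NonUnitalRings.
Context (A : nonUnitalRingType).
Implicit Types (x y z : A) (a b : nat -> A).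

Lemma numul0 x : x ** 0 = 0.
Proof. by apply: (addrI (x ** 0)); rewrite -numulDr !addr0. Qed.

Lemma mul0num x : 0 ** x = 0.
Proof. by apply: (addrI (0 ** x)); rewrite -numulDl !addr0. Qed.

Lemma numulBr x y z : x ** (y - z) = x ** y - x ** z.
Proof. by apply/eqP; rewrite eq_sym subr_eq -numulDr subrK. Qed.

Lemma numulBl x y z : (x - y) ** z = x ** z - y ** z.
Proof. by apply/eqP; rewrite eq_sym subr_eq -numulDl subrK. Qed.

Lemma numulMn x y m k : (x *+ m) ** (y *+ k) = (x ** y) *+ (m * k).
Proof.
have mulMnl k' z : (x *+ k') ** z = (x ** z) *+ k'.
  by elim: k' => [|k' IH]; rewrite ?mulr0n ?mul0num // !mulrS numulDl IH.
have mulMnr k' z : z ** (y *+ k') = (z ** y) *+ k'.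
  by elim: k' => [|k' IH]; rewrite ?mulr0n ?numul0 // !mulrS numulDr IH.
by rewrite mulMnr mulMnl mulrnA.
Qed.

Lemma oprod1 j a : oprod j j a = a j.
Proof. by rewrite /oprod subnn. Qed.

Lemma oprodS j k a : (j <= k)%N -> oprod j k.+1 a = oprod j k a ** a k.+1.
Proof.
move=> jk; rewrite /oprod subSn // -[(k - j).+1]addn1 iotaD foldl_cat /=.
by rewrite addSn subnKC.
Qed.

Lemma eq_oprod {j k a} b : (j <= k)%N ->
  (forall i, (j <= i <= k)%N -> a i = b i) -> oprod j k a = oprod j k b.
Proof.
elim: k => [|k IH]; first by rewrite leqn0 => /eqP-> ab; rewrite !oprod1 ab.
rewrite leq_eqVlt => /orP[/eqP-> ab|]; first by rewrite !oprod1 ab ?leqnn.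
rewrite ltnS => jk ab; rewrite !oprodS // IH ?ab ?leqnn ?andbT ?leqW //.
by move=> i /andP[ji ik]; rewrite ab // ji leqW.
Qed.

Lemma oprod_split j k n a : (j <= k < n)%N ->
  oprod j n a = oprod j k a ** oprod k.+1 n a.
Proof.
case/andP=> jk; elim: n => // n IH.
rewrite ltnS leq_eqVlt => /orP[/eqP <-|kn]; first by rewrite oprodS // oprod1.
by rewrite !oprodS ?(leq_trans jk (ltnW kn)) // IH // numulA.
Qed.

Lemma oprodMn j k a (m : nat -> nat) : (j <= k)%N ->
  oprod j k (fun i => a i *+ m i) = oprod j k a *+ (\prod_(j <= i < k.+1) m i)%N.
Proof.
elim: k => [|k IH]; first by rewrite leqn0 => /eqP->; rewrite !oprod1 big_nat1.
rewrite leq_eqVlt => /orP[/eqP->|]; first by rewrite !oprod1 big_nat1.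
by rewrite ltnS => jk; rewrite !oprodS // IH // numulMn -big_nat_recr ?leqW.
Qed.

End NonUnitalRings.

Lemma oprodZ (K : numFieldType) (B : banachAlgType K) j k (c : nat -> K)
    (b : nat -> B) : (j <= k)%N ->
  oprod j k (fun i => c i *: b i) = (\prod_(j <= i < k.+1) c i) *: oprod j k b.
Proof.
elim: k => [|k IH]; first by rewrite leqn0 => /eqP->; rewrite !oprod1 big_nat1.
rewrite leq_eqVlt => /orP[/eqP->|]; first by rewrite !oprod1 big_nat1.
rewrite ltnS => jk; rewrite !oprodS // IH // numul_scalel numul_scaler scalerA.
by rewrite -big_nat_recr ?leqW.
Qed.

(** * Archimedean scalars *)

Definition archimedean (K : numFieldType) :=
  forall x : K, 0 <= x -> exists N, x < N%:R.

Lemma scalar_field_archi (R : realType) (s : scalars) :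
  archimedean (scalar_field R s).
Proof.
rewrite /archimedean; case: s => /= x.
  by exists (Num.bound x); exact: archi_boundP.
move=> x0; have /complex_realP[r xE] : x \is Num.real by rewrite ger0_real.
move: x0; rewrite xE lecR => r0.
exists (Num.bound r).
by rewrite -(rmorph_nat (real_complex R)) ltcR archi_boundP.
Qed.

Section Archimedean.
Context (K : numFieldType) (archiK : archimedean K).

Lemma mulrn_bounded_eq0 (x C : K) :
  0 <= x -> (forall N, x *+ N.+1 <= C) -> x = 0.
Proof.
move=> x0 xC; apply/eqP; apply: contraT => xn0.
have xp : 0 < x by rewrite lt0r xn0.
have C0 : 0 <= C by rewrite (le_trans _ (xC 0)) // mulrn_wge0.
have [[|N]] := archiK (divr_ge0 C0 x0).
  by rewrite le_gtF // divr_ge0.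
by rewrite ltr_pdivrMr // mulr_natl => /(le_lt_trans (xC N)); rewrite ltxx.
Qed.

Lemma harmonic_small (C e : K) : 0 <= C -> 0 < e ->
  exists N0, forall N, (N0 <= N)%N -> C / N.+1%:R < e.
Proof.
move=> C0 e0; have [N0 CN0] := archiK (divr_ge0 C0 (ltW e0)).
exists N0 => N N0N; rewrite ltr_pdivrMr ?ltr0n // mulrC -ltr_pdivrMr //.
by rewrite (lt_le_trans CN0) // ler_nat leqW.
Qed.

(** Letting [M] tend to infinity in the hypothesis bounds the distance from
    [u N] to the limit, so the constant [C] is preserved: this is what gives [eps]
    itself, and not a multiple of it, as the distance from [f] to [h]. *)
Lemma harmonic_cauchy_cvg (B : completeNormedModType K) (C : K) (u : nat -> B) :
  0 <= C ->
  (forall M N, `|u M - u N| <= C / M.+1%:R + C / N.+1%:R) ->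
  exists l, forall N, `|u N - l| <= C / N.+1%:R.
Proof.
move=> C0 uC.
have /cauchy_cvg/cvg_ex[/= l ul] : cauchy (u x @[x --> \oo])%classic.
  apply: cauchy_exP => e e0; have e20 : 0 < e / 2 by rewrite divr_gt0.
  have [N0 small] := harmonic_small C0 e20.
  exists (u N0); exists N0 => // N /= N0N.
  rewrite -ball_normE /= (le_lt_trans (uC _ _)) // [e]splitr.
  by rewrite ltrD ?small.
exists l => N; apply/ler_addgt0Pr => e e0.
have e20 : 0 < e / 2 by rewrite divr_gt0.
have [N0 small] := harmonic_small C0 e20.
have /cvgrPdist_lt/(_ _ e20)[N1 _ ul1] := ul.
pose M := maxn N0 N1.
have -> : u N - l = (u N - u M) - (l - u M) by rewrite opprB addrA subrK.
rewrite (le_trans (ler_normB _ _)) // [e]splitr addrA lerD //; last first.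
  by rewrite ltW // ul1 //= leq_maxr.
by rewrite (le_trans (uC _ _)) // lerD2l ltW // small // leq_maxl.
Qed.

End Archimedean.

(** * Convergence at the rate 1 / N *)

Section HarmonicLimits.
Context (K : numFieldType) (B : normedModType K).
Implicit Types (u v : nat -> B) (x y l : B).

(** The term of index [N] stands for the average over [N.+1] summands, whence
    the factor [N.+1]. *)
Definition harmonic_limit u l :=
  exists C : K, forall N, `|u N - l| *+ N.+1 <= C.

Lemma harmonic_limit_unique (archiK : archimedean K) u x y :
  harmonic_limit u x -> harmonic_limit u y -> x = y.
Proof.
move=> [C uC] [D uD]; apply/eqP; rewrite -subr_eq0 -normr_eq0; apply/eqP.
apply: (mulrn_bounded_eq0 archiK (C := C + D)) => // N.
rewrite (le_trans _ (lerD (uC N) (uD N))) // -mulrnDl lerMn2r /=.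
by rewrite (distrC (u N)) -{1}(subrK (u N) x) -addrA ler_normD.
Qed.

Lemma harmonic_limitD u v x y : harmonic_limit u x -> harmonic_limit v y ->
  harmonic_limit (fun N => u N + v N) (x + y).
Proof.
move=> [C uC] [D vD]; exists (C + D) => N.
rewrite (le_trans _ (lerD (uC N) (vD N))) // -mulrnDl lerMn2r /=.
by rewrite opprD addrACA ler_normD.
Qed.

End HarmonicLimits.

Section HarmonicProducts.
Context (K : numFieldType) (B : banachAlgType K).

Lemma harmonic_limitM (u v : nat -> B) (x y : B) :
  harmonic_limit u x -> harmonic_limit v y ->
  harmonic_limit (fun N => u N ** v N) (x ** y).
Proof.
move=> [C uC] [D vD]; exists (C * (D + `|y|) + `|x| * D) => N.
have -> : u N ** v N - x ** y = (u N - x) ** v N + x ** (v N - y).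
  by rewrite numulBl numulBr addrA subrK.
have vle : `|v N| <= D + `|y|.
  rewrite -{1}(subrK y (v N)) (le_trans (ler_normD _ _)) // lerD2r.
  by rewrite (le_trans _ (vD N)) // mulrS lerDl mulrn_wge0.
rewrite (le_trans (ler_wMn2r _ (ler_normD _ _))) // mulrnDl lerD //.
  rewrite (le_trans (ler_wMn2r _ (normM_le _ _))) // -mulrnAl.
  by rewrite ler_pM // mulrn_wge0.
rewrite (le_trans (ler_wMn2r _ (normM_le _ _))) // -mulrnAr.
by rewrite ler_wpM2l.
Qed.

Lemma harmonic_limit_oprod j k (u : nat -> nat -> B) (l : nat -> B) :
  (j <= k)%N -> (forall i, (j <= i <= k)%N -> harmonic_limit (u i) (l i)) ->
  harmonic_limit (fun N => oprod j k (u^~ N)) (oprod j k l).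
Proof.
elim: k => [|k IH]; first rewrite leqn0 => /eqP-> ul.
  by under eq_fun do rewrite oprod1; rewrite oprod1; exact: ul.
rewrite leq_eqVlt => /orP[/eqP-> ul|].
  by under eq_fun do rewrite oprod1; rewrite oprod1; apply: ul; rewrite leqnn.
rewrite ltnS => jk ul; under eq_fun do rewrite oprodS //.
rewrite oprodS //; apply: harmonic_limitM.
  by apply: IH => // i /andP[ji ik]; apply: ul; rewrite ji leqW.
by apply: ul; rewrite leqW /=.
Qed.

End HarmonicProducts.

(** * Additive maps near an almost additive map *)

Lemma additiveMn (V W : nmodType) (h : V -> W) (hD : {morph h : x y / x + y})
    a m : h (a *+ m.+1) = h a *+ m.+1.
Proof. by elim: m => // m IH; rewrite mulrS hD IH -mulrS. Qed.

(** Since [h (a *+ N) = h a *+ N], the error [eps] is divided by [N]: an additive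
    map is determined by any map at bounded distance from it. *)
Lemma additive_harmonic_limit (K : numFieldType) (A : nmodType)
    (B : normedModType K) (eps : K) (f h : A -> B) :
  {morph h : x y / x + y} -> (forall a, `|f a - h a| <= eps) ->
  forall a, harmonic_limit (fun N => N.+1%:R^-1 *: f (a *+ N.+1)) (h a).
Proof.
move=> hD fh a; exists eps => N; rewrite -normrMn -scaler_nat scalerBr scalerA.
by rewrite divff ?pnatr_eq0 // scale1r scaler_nat -(additiveMn hD).
Qed.

Section Hyers.
Context (K : numFieldType) (archiK : archimedean K).
Context (A : nmodType) (B : completeNormedModType K) (eps : K) (f : A -> B).
Context (fD : forall a b : A, `|f (a + b) - f a - f b| <= eps).

Let eps0 : 0 <= eps := le_trans (normr_ge0 _) (fD 0 0).

Lemma approx_additiveMn a N : `|f (a *+ N.+1) - f a *+ N.+1| <= eps *+ N.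
Proof.
elim: N => [|N IH]; first by rewrite !mulr1n subrr normr0 mulr0n.
have -> : f (a *+ N.+2) - f a *+ N.+2 =
    (f (a + a *+ N.+1) - f a - f (a *+ N.+1)) + (f (a *+ N.+1) - f a *+ N.+1).
  by rewrite addrA subrK (mulrS a N.+1) (mulrS (f a) N.+1) opprD addrA.
by rewrite (le_trans (ler_normD _ _)) // (mulrS eps) lerD.
Qed.

(** Comparing both [f (a *+ p)] and [f (a *+ q)] with [f (a *+ (p * q))] shows
    that the averages of orders [p] and [q] differ by at most
    [eps / p + eps / q]. *)
Lemma hyers : exists h : A -> B,
  {morph h : x y / x + y} /\ forall a, `|f a - h a| <= eps.
Proof.
pose u a N : B := N.+1%:R^-1 *: f (a *+ N.+1).
have u_cauchy a M N : `|u a M - u a N| <= eps / M.+1%:R + eps / N.+1%:R.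
  set p := M.+1; set q := N.+1.
  have [p0 q0] : p%:R != 0 :> K /\ q%:R != 0 :> K by rewrite !pnatr_eq0.
  have -> : u a M - u a N =
      (p * q)%:R^-1 *: (f (a *+ p) *+ q - f (a *+ q) *+ p).
    rewrite scalerBr -(scaler_nat q (f (a *+ p))) -(scaler_nat p (f (a *+ q))).
    by rewrite !scalerA natrM invfM divfK // mulrAC mulVf // mul1r.
  rewrite normrZ normfV normr_nat natrM.
  rewrite ler_pdivrMl ?mulr_gt0 ?ltr0n //.
  have -> : p%:R * q%:R * (eps / p%:R + eps / q%:R) = eps *+ q + eps *+ p.
    by rewrite addf_div // mulrC divfK ?mulf_neq0 // !mulr_natr.
  have approx b m : `|f (b *+ m.+1) - f b *+ m.+1| <= eps *+ m.+1.
    by rewrite (le_trans (approx_additiveMn b m)) // ler_wpMn2l.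
  rewrite -(subrKA (f (a *+ (p * q)))) (le_trans (ler_normD _ _)) // lerD //.
    by rewrite distrC mulrnA approx.
  by rewrite mulnC mulrnA approx.
have /choice[h uh] a : exists l, forall N, `|u a N - l| <= eps / N.+1%:R.
  exact: (harmonic_cauchy_cvg archiK eps0 (u_cauchy a)).
have uh_lim a : harmonic_limit (u a) (h a).
  by exists eps => N; rewrite -mulr_natr -ler_pdivlMr ?ltr0n.
exists h; split=> [a b|a]; last first.
  (* the average over a single summand is [f a] *)
  by have := uh a 0%N; rewrite /u !mulr1n invr1 scale1r mulr1.
apply: (harmonic_limit_unique archiK _ (harmonic_limitD (uh_lim a) (uh_lim b))).
exists (eps + eps) => N; rewrite -mulr_natr -ler_pdivlMr ?ltr0n // mulrDl.
rewrite -(subrKA (u (a + b) N)) (le_trans (ler_normD _ _)) // lerD //.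
rewrite distrC opprD addrA -!scalerBr mulrnDl normrZ normfV normr_nat mulrC.
by rewrite ler_pM2r ?invr_gt0 ?ltr0n.
Qed.

End Hyers.

(** * Products with mixed factors *)

Section Stability.
Context (K : numFieldType) (archiK : archimedean K).
Context (A : nonUnitalRingType) (B : banachAlgType K).
Context (n : nat) (n_gt0 : (0 < n)%N) (delta eps : K) (f h : A -> B).
Context (fM : forall a : nat -> A,
  `|f (oprod 1 n a) - oprod 1 n (fun i => f (a i))| <= delta).
Context (hD : {morph h : x y / x + y}).
Context (fh : forall a, `|f a - h a| <= eps).

(** At the positions in [P] the argument is multiplied by [N.+1] and the value
    divided by it, so that these factors tend to [h (a i)], while multiplicativity
    up to [delta] is divided by the product [M] of all multipliers.  The position
    [i0] ensures that [M] is at least [N.+1]. *)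
Lemma mixed_oprod (P : pred nat) a i0 : (1 <= i0 <= n)%N -> P i0 ->
  h (oprod 1 n a) = oprod 1 n (fun i => if P i then h (a i) else f (a i)).
Proof.
move=> i0n Pi0.
pose m N i := if P i then N.+1 else 1%N.
pose u i N : B := (m N i)%:R^-1 *: f (a i *+ m N i).
apply: (harmonic_limit_unique archiK (u := fun N => oprod 1 n (u^~ N))); last first.
  apply: harmonic_limit_oprod => // i _; rewrite /u /m.
  case: (P i); first exact: additive_harmonic_limit fh (a i).
  by exists 0 => N; rewrite invr1 scale1r mulr1n subrr normr0 mul0rn.
exists (delta + eps) => N.
set M := (\prod_(1 <= i < n.+1) m N i)%N.
have NM : (N.+1 <= M)%N.
  rewrite dvdn_leq //.
    by rewrite prodn_gt0 // => i; rewrite /m; case: (P i).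
  rewrite /M (bigD1_seq i0) ?iota_uniq ?mem_index_iota //= /m Pi0.
  exact: dvdn_mulr.
have -> : oprod 1 n (u^~ N) = M%:R^-1 *: oprod 1 n (fun i => f (a i *+ m N i)).
  by rewrite oprodZ // /M natr_prod prodfV.
have M0 : M%:R != 0 :> K by rewrite pnatr_eq0 -lt0n (leq_trans _ NM).
rewrite (le_trans (ler_wpMn2l _ NM)) // -normrMn -scaler_nat scalerBr scalerA.
rewrite divff // scale1r scaler_nat.
have -> : h (oprod 1 n a) *+ M = h (oprod 1 n (fun i => a i *+ m N i)).
  rewrite oprodMn // -/M; case: (M) NM => // M' _; exact/esym/additiveMn.
rewrite -(subrKA (f (oprod 1 n (fun i => a i *+ m N i)))).
by rewrite (le_trans (ler_normD _ _)) // lerD // distrC fM.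
Qed.

End Stability.

Theorem theorem2p1 (n : nat) (hn : (2 <= n)%N)
    (A : nonUnitalRingType)
    (R : realType) (s : scalars) (B : banachAlgType (scalar_field R s))
    (delta eps : scalar_field R s) (hdelta : 0 <= delta) (heps : 0 <= eps)
    (f : A -> B)
    (fD : forall a b : A, `|f (a + b) - f a - f b| <= eps)
    (fM : forall a : nat -> A,
      `|f (\oprod_(1 <= i <= n) a i) - \oprod_(1 <= i <= n) f (a i)| <= delta) :
  exists h : A -> B,
    unique (fun g : A -> B =>
      nring_hom n g /\ forall a : A, `|f a - g a| <= eps) h
    /\ forall (a : nat -> A) (k : nat), (1 <= k <= n - 1)%N ->
      (\oprod_(1 <= i <= k) h (a i)) **
        (\oprod_(k.+1 <= i <= n) f (a i) - \oprod_(k.+1 <= i <= n) h (a i)) = 0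
      /\
      (\oprod_(1 <= i <= k) f (a i) - \oprod_(1 <= i <= k) h (a i)) **
        (\oprod_(k.+1 <= i <= n) h (a i)) = 0.
Proof.
have archiK := @scalar_field_archi R s.
have n0 : (0 < n)%N := ltnW hn.
have [h [hD fh]] := hyers archiK fD.
have mixed := mixed_oprod archiK n0 fM hD fh.
have hM a : h (oprod 1 n a) = oprod 1 n (h \o a).
  by rewrite (mixed predT a 1%N) // n0.
exists h; split.
  split=> [//|g [[gD _] fg]]; apply/funext => a.
  exact: (harmonic_limit_unique archiK (additive_harmonic_limit hD fh a)
    (additive_harmonic_limit gD fg a)).
move=> a k /andP[k1 kn]; have {}kn : (k < n)%N by rewrite -(subnK n0) addn1 ltnS.
have split_n (b : nat -> B) : oprod 1 n b = oprod 1 k b ** oprod k.+1 n b.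
  by rewrite (@oprod_split _ 1 k) // k1.
have left i : (1 <= i <= k)%N -> (i <= k)%N by case/andP.
have right i : (k.+1 <= i <= n)%N -> (i <= k)%N = false.
  by case/andP => ki _; rewrite leqNgt ki.
split; apply/eqP; rewrite ?numulBr ?numulBl subr_eq0; apply/eqP.
  (* [h] on the first [k] factors, [f] on the others *)
  rewrite -(split_n (h \o a)) -hM (mixed (leq^~ k) a 1%N) ?n0 // split_n.
  congr (_ ** _); apply: eq_oprod => // i; first by move/left->.
  by move/right->.
(* [f] on the first [k] factors, [h] on the others *)
rewrite -(split_n (h \o a)) -hM (mixed (ltn k) a n) ?n0 ?leqnn // split_n.
congr (_ ** _); apply: eq_oprod => // i ik; rewrite /= (ltnNge k i).
  by rewrite left.
by rewrite right.
Qed.
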